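(* Let $D\subset\mathbb{C}^n$ be an open domain and let $F=F(z,v)$ be a strongly convex complex Finsler metric on $D$. Then: (i) $F$ is projectively flat if and only if $F$ comes from a strongly convex complex Minkowski metric, i.e. there is a strongly convex complex Minkowski norm $f:\mathbb{C}^n\to[0,+\infty)$ such that $F(z,v)=f(v)$ for all $z\in D$ and $v\in\mathbb{C}^n$; (ii) $F$ is dually flat if and only if $F$ comes from a strongly convex complex Minkowski metric, i.e. there is a strongly convex complex Minkowski norm $f:\mathbb{C}^n\to[0,+\infty)$ such that $F(z,v)=f(v)$ for all $z\in D$ and $v\in\mathbb{C}^n$.
   Context: A domain is a nonempty connected open set. **Real Minkowski norm and real Finsler metric.** A real Minkowski norm on $\mathbb{R}^m$ is a function $F:\mathbb{R}^m\to[0,+\infty)$ that is $C^\infty$ on $\mathbb{R}^m\setminus\{0\}$, satisfies $F(\lambda u)=|\lambda|F(u)$ for all $\lambda\in\mathbb{R}$, $u\in\mathbb{R}^m$, and is strongly convex: the matrix $\frac12\frac{\partial^2F^2}{\partial u^a\partial u^b}(u)$ is positive definite for all $u\neq0$. A real Finsler metric on an open set $D\subset\mathbb{R}^m$ is a function $F:D\times\mathbb{R}^m\to[0,+\infty)$, $(x,u)\mapsto F(x,u)$, that is $C^\infty$ on $D\times(\mathbb{R}^m\setminus\{0\})$ and such that $F(x,\cdot)$ is a real Minkowski norm for each $x\in D$. **Complex Minkowski norm and complex Finsler metric.** A complex Minkowski norm on $\mathbb{C}^n$ is a function $f:\mathbb{C}^n\to[0,+\infty)$ that is $C^\infty$ on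 $\mathbb{C}^n\setminus\{0\}$, satisfies $f(\lambda v)=|\lambda|f(v)$ for all $\lambda\in\mathbb{C}$, $v\in\mathbb{C}^n$, and is strongly pseudoconvex: the matrix $\frac{\partial^2f^2}{\partial v^\alpha\partial\overline{v^\beta}}(v)$ is positive definite for all $v\neq0$. A (strongly pseudoconvex) complex Finsler metric on an open set $D\subset\mathbb{C}^n$ is a function $F:T^{1,0}D\cong D\times\mathbb{C}^n\to[0,+\infty)$, $(z,v)\mapsto F(z,v)$, that is $C^\infty$ on $D\times(\mathbb{C}^n\setminus\{0\})$ and such that $F(z,\cdot)$ is a complex Minkowski norm for each $z\in D$. **Strong convexity.** Write $z^i=x^i+\sqrt{-1}\,x^{i+n}$ and $v^i=u^i+\sqrt{-1}\,u^{i+n}$, $i=1,\dots,n$, which identifies $\mathbb{C}^n$ with $\mathbb{R}^{2n}$ and $T^{1,0}D$ with the real tangent bundle $D\times\mathbb{R}^{2n}$. A complex Finsler metric $F$ (or complex Minkowski norm) is strongly convex if, regarded via this identification as a function of $(x,u)\in D\times\mathbb{R}^{2n}$ (resp. $u\in\mathbb{R}^{2n}$), it is a real Finsler metric (resp. real Minkowski norm). The same symbol $F$ is used for the associated real Finsler metric $F(x,u)$. **Projectively flat and dually flat.** A strongly convex complex Finsler metric $F$ on $D\subset\mathbb{C}^n\cong\mathbb{R}^{2n}$ is called projectively flat (resp. dually flat) if the associated real Finsler metric $F(x,u)$ is so in the real sense. Projectively flat means that the geodesics of $F(x,u)$ are straight lines; equivalently (Hamel), on $D\times(\mathbb{R}^{2n}\setminus\{0\})$,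 $$\sum_{b=1}^{2n}\frac{\partial^2F}{\partial x^b\partial u^a}u^b=\frac{\partial F}{\partial x^a},\qquad a=1,\dots,2n.$$ Dually flat means that, on $D\times(\mathbb{R}^{2n}\setminus\{0\})$, $$\sum_{b=1}^{2n}\frac{\partial^2F^2}{\partial x^b\partial u^a}u^b=2\frac{\partial F^2}{\partial x^a},\qquad a=1,\dots,2n.$$ *)

(* Defs.v *)
From HB Require Import structures.
From mathcomp Require Import all_boot all_order all_algebra complex.
From mathcomp Require Import all_classical all_reals all_analysis.
Set Implicit Arguments.
Unset Strict Implicit.
Unset Printing Implicit Defensive.
Import Order.TTheory GRing.Theory Num.Theory.
Import numFieldNormedType.Exports.
Local Open Scope classical_set_scope.
Local Open Scope complex_scope.
Local Open Scope ring_scope.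

Section RealFinsler.
Context {R : realType}.

Definition partial m (a : 'I_m) (f : 'rV[R]_m -> R) (x : 'rV[R]_m) : R :=
  'D_(delta_mx 0 a) f x.

(* [partials [:: a1; ..; ak] f] is d/dx^a1 ( .. (d/dx^ak f)). *)
Definition partials m (s : seq 'I_m) (f : 'rV[R]_m -> R) : 'rV[R]_m -> R :=
  foldr (@partial m) f s.

(* C^oo on an open set U: the partial derivatives of all orders exist and are
   continuous at every point of U. *)
Definition smooth_on m (U : set 'rV[R]_m) (f : 'rV[R]_m -> R) : Prop :=
  forall (s : seq 'I_m) (x : 'rV[R]_m), U x ->
    {for x, continuous (partials s f)} /\
    (forall a : 'I_m, derivable (partials s f) x (delta_mx 0 a)).

Definition real_posdef m (A : 'M[R]_m) : Prop :=
  forall w : 'rV[R]_m, w != 0 -> 0 < (w *m A *m w^T) 0 0.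

Definition fundamental_mx m (f : 'rV[R]_m -> R) (u : 'rV[R]_m) : 'M[R]_m :=
  \matrix_(a, b) (2^-1 * partial a (partial b (fun y => f y ^+ 2)) u).

Definition real_minkowski m (f : 'rV[R]_m -> R) : Prop :=
  [/\ forall u, 0 <= f u,
      smooth_on [set u | u != 0] f,
      forall (l : R) u, f (l *: u) = `|l| * f u
    & forall u, u != 0 -> real_posdef (fundamental_mx f u)].

(* A metric on D is a total curried function of which only the values over D
   matter; D x (R^m minus 0) is viewed inside R^(m + m), with x in the first m
   coordinates and u in the last m. *)
Definition smooth_metric m (D : set 'rV[R]_m)
    (F : 'rV[R]_m -> 'rV[R]_m -> R) : Prop :=
  smooth_on [set w : 'rV[R]_(m + m) | D (lsubmx w) /\ rsubmx w != 0]
            (fun w => F (lsubmx w) (rsubmx w)).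

Definition real_finsler m (D : set 'rV[R]_m)
    (F : 'rV[R]_m -> 'rV[R]_m -> R) : Prop :=
  smooth_metric D F /\
  (forall x, D x -> real_minkowski (F x)).

(* [dx b (du a F)] is the mixed derivative d^2 F / dx^b du^a. *)
Definition dx m (b : 'I_m) (F : 'rV[R]_m -> 'rV[R]_m -> R) :
    'rV[R]_m -> 'rV[R]_m -> R := fun x u => partial b (fun y => F y u) x.
Definition du m (a : 'I_m) (F : 'rV[R]_m -> 'rV[R]_m -> R) :
    'rV[R]_m -> 'rV[R]_m -> R := fun x u => partial a (F x) u.

(* The geodesics of F are straight lines, expressed by Hamel's equations. *)
Definition real_projectively_flat m (D : set 'rV[R]_m)
    (F : 'rV[R]_m -> 'rV[R]_m -> R) : Prop :=
  forall x u, D x -> u != 0 -> forall a : 'I_m,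
    \sum_(b < m) dx b (du a F) x u * u 0 b = dx a F x u.

Definition real_dually_flat m (D : set 'rV[R]_m)
    (F : 'rV[R]_m -> 'rV[R]_m -> R) : Prop :=
  let F2 x u := F x u ^+ 2 in
  forall x u, D x -> u != 0 -> forall a : 'I_m,
    \sum_(b < m) dx b (du a F2) x u * u 0 b = 2 * dx a F2 x u.

End RealFinsler.

Section ComplexFinsler.
Context {R : realType}.

(* The type annotation R[i]^o selects the topology of 'rV[R[i]]_n induced by
   the modulus on R[i]. *)
Definition complex_domain n (D : set 'rV[R[i]]_n) : Prop :=
  [/\ D !=set0, open (D : set 'rV[R[i]^o]_n)
    & connected (D : set 'rV[R[i]^o]_n)].

(* The identification of C^n with R^(2n): z^i = x^i + sqrt(-1) x^(i+n). *)
Definition to_real n (z : 'rV[R[i]]_n) : 'rV[R]_(n + n) :=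
  row_mx (\row_i complex.Re (z 0 i)) (\row_i complex.Im (z 0 i)).
Definition to_complex n (x : 'rV[R]_(n + n)) : 'rV[R[i]]_n :=
  \row_i (x 0 (lshift n i) +i* x 0 (rshift n i)).

Definition real_domain n (D : set 'rV[R[i]]_n) : set 'rV[R]_(n + n) :=
  [set x | D (to_complex x)].

Definition to_real_metric n (F : 'rV[R[i]]_n -> 'rV[R[i]]_n -> R) :
    'rV[R]_(n + n) -> 'rV[R]_(n + n) -> R :=
  fun x u => F (to_complex x) (to_complex u).

Definition cpartial n (a : 'I_(n + n)) (g : 'rV[R[i]]_n -> R[i]) :
    'rV[R[i]]_n -> R[i] := fun v =>
  partial a (fun u => complex.Re (g (to_complex u))) (to_real v) +i*
  partial a (fun u => complex.Im (g (to_complex u))) (to_real v).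

(* The Wirtinger derivatives d/dv^k and d/d(conj v^k). *)
Definition wirtinger n (k : 'I_n) (g : 'rV[R[i]]_n -> R[i]) :
    'rV[R[i]]_n -> R[i] := fun v =>
  2^-1 * (cpartial (lshift n k) g v - 'i%C * cpartial (rshift n k) g v).
Definition wirtinger_bar n (k : 'I_n) (g : 'rV[R[i]]_n -> R[i]) :
    'rV[R[i]]_n -> R[i] := fun v =>
  2^-1 * (cpartial (lshift n k) g v + 'i%C * cpartial (rshift n k) g v).

(* Over R[i], 0 < z means that z is real and positive. *)
Definition complex_posdef n (A : 'M[R[i]]_n) : Prop :=
  forall w : 'rV[R[i]]_n, w != 0 ->
    0 < (w *m A *m (map_mx conjc w)^T) 0 0.

Definition levi_mx n (f : 'rV[R[i]]_n -> R) (v : 'rV[R[i]]_n) : 'M[R[i]]_n :=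
  \matrix_(a, b) wirtinger a (wirtinger_bar b (fun w => (f w ^+ 2)%:C)) v.

Definition complex_minkowski n (f : 'rV[R[i]]_n -> R) : Prop :=
  [/\ forall v, 0 <= f v,
      smooth_on [set u : 'rV[R]_(n + n) | u != 0] (f \o @to_complex n),
      forall (l : R[i]) v, (f (l *: v))%:C = `|l| * (f v)%:C
    & forall v, v != 0 -> complex_posdef (levi_mx f v)].

Definition complex_finsler n (D : set 'rV[R[i]]_n)
    (F : 'rV[R[i]]_n -> 'rV[R[i]]_n -> R) : Prop :=
  smooth_metric (real_domain D) (to_real_metric F) /\
  (forall z, D z -> complex_minkowski (F z)).

Definition strongly_convex_norm n (f : 'rV[R[i]]_n -> R) : Prop :=
  real_minkowski (f \o @to_complex n).

Definition strongly_convex_metric n (D : set 'rV[R[i]]_n)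
    (F : 'rV[R[i]]_n -> 'rV[R[i]]_n -> R) : Prop :=
  real_finsler (real_domain D) (to_real_metric F).

Definition projectively_flat n (D : set 'rV[R[i]]_n)
    (F : 'rV[R[i]]_n -> 'rV[R[i]]_n -> R) : Prop :=
  real_projectively_flat (real_domain D) (to_real_metric F).

Definition dually_flat n (D : set 'rV[R[i]]_n)
    (F : 'rV[R[i]]_n -> 'rV[R[i]]_n -> R) : Prop :=
  real_dually_flat (real_domain D) (to_real_metric F).

End ComplexFinsler.

(* Main.v *)
(** Write g(x, u) for F or F^2, so that flatness reads
    sum_b g_{x^b u^a} u^b = c g_{x^a} with c = 1 or 2, and let J be the
    multiplication by i.  Homogeneity of F over C makes t |-> g(x, u + t Ju)
    even, hence sum_a g_{u^a}(x, u) (Ju)^a = 0 for all x in D.  Differentiating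
    this along (u, 0) and using the flatness equation gives
    sum_a g_{x^a}(x, u) (Ju)^a = 0, and then sum_a g_{x^a}(x, u) u^a = 0 because
    g(x, Ju) = g(x, u).  So g(x + tu, u) = g(x, u) for small t; differentiating
    first in u and then in t at 0 gives sum_b g_{x^b u^a} u^b = - g_{x^a}.  With
    the flatness equation (c + 1) g_{x^a} = 0, so g does not depend on x. *)
From HB Require Import structures.
Require Import Defs.
From mathcomp Require Import all_boot all_order all_algebra complex.
From mathcomp Require Import all_classical all_reals all_analysis.
From mathcomp Require Import lra.
Set Implicit Arguments.
Unset Strict Implicit.
Unset Printing Implicit Defensive.
Import Order.TTheory GRing.Theory Num.Theory.
Import numFieldNormedType.Exports.
Local Open Scope classical_set_scope.
Local Open Scope ring_scope.

(** * Sup norm of row vectors and a mean value bound on a line *)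

Lemma normrV_le (R : realType) m (v : 'rV[R]_m) (e : R) :
  0 <= e -> (forall i, `|v 0 i| <= e) -> `|v| <= e.
Proof.
move=> e0 ve; rewrite [leLHS]/Num.norm /= mx_normrE.
by apply: bigmax_le => // -[i j] _ /=; rewrite ord1.
Qed.

Lemma coord_le_normrV (R : realType) m (v : 'rV[R]_m) i : `|v 0 i| <= `|v|.
Proof.
rewrite [leRHS]/Num.norm /= mx_normrE; apply/bigmax_geP; right.
by exists (0, i).
Qed.

Lemma is_derive_line (R : realType) (V : normedModType R) (f : V -> R)
    (x v : V) (t : R) :
  derivable f (x + t *: v) v ->
  is_derive t (1 : R) (fun s : R => f (x + s *: v)) ('D_v f (x + t *: v)).
Proof.
move=> dfv.
have E : (fun h : R =>
      h^-1 *: (f (x + (h *: (1 : R) + t) *: v) - f (x + t *: v))) = (fun h : R => h^-1 *: (f (h *: v + (x + t *: v)) - f (x + t *: v))).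
  apply/funext => h; congr (_ *: (f _ - _)).
  by rewrite [_%:A]mulr1 scalerDl addrCA.
by split; rewrite /derivable /derive /= E.
Qed.

(** The mean value theorem on [0, t] or [t, 0], according to the sign of [t]; the condition
    [|s| <= |t|] covers both cases without a split in the statement. *)
Lemma derive_bound_lipschitz0 (R : realType) (phi : R -> R) (t e : R) :
  (forall s, `|s| <= `|t| -> derivable phi s 1 /\ `|'D_1 phi s| <= e) ->
  `|phi t - phi 0| <= e * `|t|.
Proof.
move=> H; have [t0|t0] := leP 0 t.
  have Hi s : s \in `[0, t]%R -> `|s| <= `|t|.
    by rewrite in_itv /= => /andP[s0 st]; rewrite !ger0_norm.
  have [|||c /Hi/H[_ De] ->] := @MVT_segment R phi (fun s => 'D_1 phi s) 0 t.
  - by [].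
  - by move=> s /subset_itv_oo_cc/Hi/H[? _]; apply/derivableP.
  - by apply: derivable_within_continuous => s /Hi/H[].
  by rewrite subr0 normrM ler_wpM2r.
have Hi s : s \in `[t, 0]%R -> `|s| <= `|t|.
  rewrite in_itv /= => /andP[ts s0].
  by rewrite (ler0_norm s0) (ler0_norm (ltW t0)) lerN2.
rewrite distrC.
have [|||c /Hi/H[_ De] ->] := @MVT_segment R phi (fun s => 'D_1 phi s) t 0.
- exact: ltW.
- by move=> s /subset_itv_oo_cc/Hi/H[? _]; apply/derivableP.
- by apply: derivable_within_continuous => s /Hi/H[].
by rewrite sub0r normrM normrN ler_wpM2r.
Qed.

(** * Continuous partial derivatives imply differentiability *)

Section ContinuousPartials.
Variables (R : realType) (m : nat).
Implicit Types (f : 'rV[R]_m -> R) (x h : 'rV[R]_m).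

(** Vertices of a broken line from 0 ([k = 0]) to [h] ([k = m]), whose edges are parallel to the
    axes. *)
Let trunc (h : 'rV[R]_m) (k : nat) : 'rV[R]_m :=
  \row_(a < m) (if (a < k)%N then h 0 a else 0).

Let truncS h (k : 'I_m) : trunc h k.+1 = trunc h k + h 0 k *: delta_mx 0 k.
Proof.
apply/rowP => a; rewrite !mxE eqxx /= ltnS leq_eqVlt.
have [->|ak] := eqVneq a k; first by rewrite eqxx ltnn /= mulr1 add0r.
by rewrite -[(_ == _ :> nat)]/(a == k) (negbTE ak) /= mulr0 addr0.
Qed.

(** In the sup norm no point of the broken line is farther from 0 than [h], so a ball around [x]
    that contains [x + h] contains the whole translated line. *)
Let norm_trunc h (k : 'I_m) (t : R) : `|t| <= `|h 0 k| ->
  `|trunc h k + t *: delta_mx 0 k| <= `|h|.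
Proof.
move=> th; apply: normrV_le => // a; rewrite !mxE eqxx /=.
have [->|ak] := eqVneq a k.
  by rewrite ltnn mulr1 add0r (le_trans th) ?coord_le_normrV.
by rewrite mulr0 addr0; case: ifP => _; rewrite ?normr0 ?coord_le_normrV.
Qed.

(* Along the broken line that adds the coordinates of h one at a time, each
   step is controlled by the mean value theorem. *)
Lemma continuous_partials_differentiable f x :
  (forall a, (\forall y \near x, derivable f y (delta_mx 0 a)) /\
             {for x, continuous (partial a f)}) ->
  differentiable f x.
Proof.
move=> Hf.
pose L (v : 'rV[R]_m) : R := \sum_a v 0 a * partial a f x.
have linL : linear L.
  move=> c u v; rewrite /L scaler_sumr -big_split; apply: eq_bigr => a _ /=.
  by rewrite !mxE mulrDl -mulrA.
have [dL EdL] : exists dL : {linear 'rV[R]_m -> R}, dL = L :> (_ -> _).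
  pose LM := GRing.isLinear.Build _ _ _ _ _ linL.
  pose dL : {linear 'rV[R]_m -> R} := HB.pack L LM.
  by exists dL.
have cdL : continuous dL.
  rewrite EdL; apply: continuous_big => [|a _ v]; first exact: add_continuous.
  have cc : {for v, continuous (fun v : 'rV[R]_m => v 0 a)}.
    exact: coord_continuous.
  exact: (continuousM cc (@cst_continuous _ _ _ v)).
have exp : f \o shift x = cst (f x) + (dL : _ -> R^o) +o_ (0 : 'rV[R]_m) id.
  apply/eqaddoP => e e0.
  (* Each of the [m] edges costs [e' * |h|], and [m * e' <= e]; the successor keeps the denominator
     nonzero when [m = 0]. *)
  pose e' := e / m.+1%:R.
  have e'0 : 0 < e' by rewrite divr_gt0.
  have Hn : \forall y \near x, forall a, derivable f y (delta_mx 0 a) /\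
      `|partial a f y - partial a f x| <= e'.
    suff Ha (a : 'I_m) : \forall y \near x, derivable f y (delta_mx 0 a) /\
        `|partial a f y - partial a f x| <= e'
      by exact: (@filter_forall _ _ (fun a => [set y | derivable f y (delta_mx 0 a) /\
        `|partial a f y - partial a f x| <= e']) (nbhs x) _ Ha).
    have [H1 /cvgrPdist_le/(_ _ e'0) H2] := Hf a.
    by apply: filterS2 H1 H2 => y ? ?; split => //; rewrite distrC.
  move/nbhs_ballP : Hn => [r /= r0 Hr].
  near=> h.
  have hr : `|h| < r by near: h; exact: (@nbhs0_lt _ 'rV[R]_m).
  have step (k : 'I_m) : `|f (x + trunc h k.+1) - f (x + trunc h k) -
      h 0 k * partial k f x| <= e' * `|h|.
    (* With the linear term subtracted, the derivative of [phi] is the difference of the [k]-th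
       partial at a point of the edge and at [x], which [Hr] bounds by [e']. *)
    pose phi (t : R) := f (x + trunc h k + t *: delta_mx 0 k) - t * partial k f x.
    have := @derive_bound_lipschitz0 R phi (h 0 k) e'.
    rewrite /phi scale0r mul0r subr0 addr0 -[x + _ + _ *: _]addrA -truncS => H.
    rewrite addrAC; apply: le_trans (H _) _; last first.
      by rewrite ler_pM2l // coord_le_normrV.
    move=> s sh.
    have [|D1 D2] := Hr (x + trunc h k + s *: delta_mx 0 k) _ k.
      rewrite -ball_normE /= -addrA opprD addNKr normrN.
      exact: le_lt_trans (norm_trunc sh) hr.
    have I1 := is_derive_line D1.
    have I2 : is_derive s (1:R) (fun t : R => t * partial k f x) (partial k f x).
      have -> : (fun t : R => t * partial k f x) = partial k f x *: (id : R -> R^o).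
        by apply/funext => t; rewrite /= mulrC.
      by apply: is_derive_eq; rewrite [_ *: _]mulr1.
    have I := is_deriveB I1 I2.
    split; first exact: ex_derive.
    rewrite (@derive_val _ _ _ _ _ _ _ I).
    exact: D2.
  have -> : (f \o shift x - (cst (f x) + dL)) h =
    \sum_(k < m) (f (x + trunc h k.+1) - f (x + trunc h k) -
      h 0 k * partial k f x).
    rewrite sumrB.
    have := telescope_sumr (fun k => f (x + trunc h k)) (leq0n m).
    rewrite big_mkord => ->.
    have -> : trunc h m = h by apply/rowP => a; rewrite mxE ltn_ord.
    have -> : trunc h 0 = 0 by apply/rowP => a; rewrite !mxE.
    rewrite -[LHS]/(f (h + x) - (f x + dL h)) EdL [h + x]addrC addr0.
    by rewrite opprD addrA.
  apply: le_trans (ler_norm_sum _ _ _) _.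
  apply: le_trans (ler_sum _ (fun k _ => step k)) _.
  rewrite sumr_const card_ord -mulr_natl mulrA ler_wpM2r // /e'.
  rewrite mulrCA ger_pMr // ler_pdivrMr ?ltr0Sn // mul1r ler_nat //.
apply/diff_locallyP; rewrite (diff_unique cdL exp).
by split.
Unshelve. all: by end_near. Qed.
End ContinuousPartials.

(** * Directional derivatives and their dependence on values along a line *)

(** A directional derivative sees only the values on one line, so functions on different spaces can
    be compared. This serves for all later changes of variables. *)
Lemma eq_derive_line (R : realType) (V W : normedModType R) (f : V -> R)
    (g : W -> R) (x v : V) (y w : W) :
  (forall h : R, f (h *: v + x) = g (h *: w + y)) -> 'D_v f x = 'D_w g y.
Proof.
move=> fg; rewrite /derive.
have fg0 : f x = g y by have := fg 0; rewrite !scale0r !add0r.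
rewrite (_ : (fun h => h^-1 *: ((f \o shift x) _ - _)) =
  (fun h => h^-1 *: ((g \o shift y) (h *: w) - g y))) //.
by apply/funext => h /=; rewrite fg fg0.
Qed.

(** The mean value bound with constant 0. *)
Lemma constant_on_line (R : realType) (V : normedModType R) (f : V -> R)
    (x v : V) (T : R) :
  (forall t, `|t| <= `|T| ->
     derivable f (x + t *: v) v /\ 'D_v f (x + t *: v) = 0) ->
  f (x + T *: v) = f x.
Proof.
move=> H; have := @derive_bound_lipschitz0 R (fun t => f (x + t *: v)) T 0.
rewrite scale0r addr0 mul0r normr_le0 subr_eq0 => E; apply/eqP/E => s /H[H1 H2].
have I := is_derive_line H1.
by split; [exact: ex_derive | rewrite derive_val H2 normr0].
Qed.

Lemma eq_derivable_line (R : realType) (V W : normedModType R) (f : V -> R)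
    (g : W -> R) (x v : V) (y w : W) :
  (forall h : R, f (h *: v + x) = g (h *: w + y)) ->
  derivable f x v -> derivable g y w.
Proof.
move=> fg; rewrite /derivable.
have fg0 : f x = g y by have := fg 0; rewrite !scale0r !add0r.
rewrite (_ : (fun h => h^-1 *: ((f \o shift x) _ - _)) =
  (fun h => h^-1 *: ((g \o shift y) (h *: w) - g y))) //.
by apply/funext => h /=; rewrite fg fg0.
Qed.

Lemma near_eq_differentiable (R : realType) (V : normedModType R)
    (f g : V -> R) (x : V) :
  (\forall y \near x, f y = g y) -> differentiable f x -> differentiable g x.
Proof.
move=> fg dfx; have cdf := diff_continuous dfx.
have fgx : f x = g x := nbhs_singleton fg.
have exp : g \o shift x = cst (g x) + ('d f x : V -> R^o) +o_ (0 : V) id.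
  apply/eqaddoP => e e0.
  have /eqaddoP/(_ e e0) H := diff_locally dfx.
  have fg' : \forall h \near (0 : V), f (h + x) = g (h + x).
    have hx : h + x @[h --> (0 : V)] --> x.
      by rewrite -[X in _ --> X]add0r; apply: (@cvgD _ _ _ _ _ id (cst x));
        [exact: cvg_id | exact: cvg_cst].
    exact: hx fg.
  apply: filterS2 fg' H => h fgh le_e.
  have : `|f (h + x) - (f x + 'd f x h)| <= e * `|h| := le_e.
  by rewrite fgh fgx.
apply/diff_locallyP; rewrite (diff_unique cdf exp).
by split.
Qed.

Lemma derive_sum_partial (R : realType) m (f : 'rV[R]_m -> R) (x v : 'rV[R]_m) :
  differentiable f x -> 'D_v f x = \sum_a v 0 a * partial a f x.
Proof.
move=> fx; rewrite deriveE // [in LHS](row_sum_delta v) linear_sum.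
by apply: eq_bigr => a _; rewrite linearZ /partial deriveE.
Qed.

Lemma sum_delta (R : realType) m (a : 'I_m) (c : 'I_m -> R) :
  \sum_b (delta_mx 0 a : 'rV[R]_m) 0 b * c b = c a.
Proof.
rewrite (bigD1 a) //= mxE !eqxx mul1r big1 ?addr0 // => b /negbTE ba.
by rewrite mxE ba andbF mul0r.
Qed.

(** * Derivatives in the block coordinates (x, u) *)

Section Blocks.
Variables (R : realType) (m k : nat).
Implicit Types (g : 'rV[R]_(m + k) -> R) (x p : 'rV[R]_m) (u q : 'rV[R]_k).

Lemma delta_lshift (a : 'I_m) :
  delta_mx 0 (lshift k a) = row_mx (delta_mx 0 a) 0 :> 'rV[R]_(m + k).
Proof. by rewrite -[LHS]hsubmxK; congr row_mx; apply/rowP => b; rewrite !mxE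
  ?(inj_eq (@lshift_inj _ _)) ?eq_rlshift ?andbF. Qed.

Lemma delta_rshift (a : 'I_k) :
  delta_mx 0 (rshift m a) = row_mx 0 (delta_mx 0 a) :> 'rV[R]_(m + k).
Proof. by rewrite -[LHS]hsubmxK; congr row_mx; apply/rowP => b; rewrite !mxE
  ?(inj_eq (@rshift_inj _ _)) ?eq_lrshift ?andbF. Qed.

Lemma derive_row_mxl g x u p :
  'D_(row_mx p 0) g (row_mx x u) = 'D_p (fun y => g (row_mx y u)) x.
Proof.
apply: eq_derive_line => h.
by rewrite scale_row_mx scaler0 add_row_mx add0r.
Qed.

Lemma derivable_row_mxl g x u p :
  derivable g (row_mx x u) (row_mx p 0) -> derivable (fun y => g (row_mx y u)) x p.
Proof.
apply: eq_derivable_line => h.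
by rewrite scale_row_mx scaler0 add_row_mx add0r.
Qed.

Lemma derive_row_mxr g x u q :
  'D_(row_mx 0 q) g (row_mx x u) = 'D_q (fun y => g (row_mx x y)) u.
Proof.
apply: eq_derive_line => h.
by rewrite scale_row_mx scaler0 add_row_mx add0r.
Qed.

Lemma derive_row_mx g x u p q : differentiable g (row_mx x u) ->
  'D_(row_mx p q) g (row_mx x u) =
  \sum_a p 0 a * partial (lshift k a) g (row_mx x u) +
  \sum_a q 0 a * partial (rshift m a) g (row_mx x u).
Proof.
move=> /derive_sum_partial ->; rewrite big_split_ord /=.
by congr (_ + _); apply: eq_bigr => a _; rewrite ?row_mxEl ?row_mxEr.
Qed.
End Blocks.

(** * Derivatives of even functions, and limits along a line *)

(** Reflecting the line gives the same derivative along [- v] as along [v], while linearity of the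
    differential gives the opposite one. *)
Lemma derive_even (R : realType) (V : normedModType R) (f : V -> R) (x v : V) :
  differentiable f x -> (forall t : R, f (x + t *: v) = f (x - t *: v)) ->
  'D_v f x = 0.
Proof.
move=> fx ev; have : 'D_(- v) f x = 'D_v f x.
  apply: eq_derive_line => h.
  by rewrite scalerN addrC -ev addrC.
by rewrite !deriveE // linearN => E; lra.
Qed.

Lemma cvg_line (R : realType) (V : normedModType R) (x v : V) :
  x + t *: v @[t --> (0 : R)] --> x.
Proof.
have : (fun t : R => x + t *: v) @ 0 --> x + (0 : R) *: v.
  by apply: (@cvgD _ _ _ _ _ (cst x)); [exact: cvg_cst | exact: scalel_continuous].
by rewrite scale0r addr0.
Qed.

Lemma cvg_derive (R : realType) (V : normedModType R) (f : V -> R)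
    (x v : V) : derivable f x v ->
  h^-1 * (f (x + h *: v) - f x) @[h --> (0 : R)^'] --> 'D_v f x.
Proof.
move=> fx; have E : (fun h : R => h^-1 * (f (x + h *: v) - f x)) =
    (fun h => h^-1 *: ((f \o shift x) (h *: v) - f x)).
  by apply/funext => h /=; rewrite [x + _]addrC.
rewrite E; exact: fx.
Qed.

(** * Vanishing of the horizontal derivatives under Hamel's equations *)

Section HamelRigidity.
Variables (R : realType) (m : nat) (D : set 'rV[R]_m).
Variables (g : 'rV[R]_(m + m) -> R) (J : 'rV[R]_m -> 'rV[R]_m) (c : R).
Hypothesis oD : open D.
Hypothesis dg : forall x u, D x -> u != 0 -> differentiable g (row_mx x u).
Hypothesis dpg : forall x u, D x -> u != 0 ->
  forall a, differentiable (partial a g) (row_mx x u).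
Hypothesis J0 : J 0 = 0.
Hypothesis JJ : forall u, J (J u) = - u.
Hypothesis gJ : forall x u, D x -> g (row_mx x (J u)) = g (row_mx x u).
Hypothesis gJeven : forall x u (t : R), D x ->
  g (row_mx x (u + t *: J u)) = g (row_mx x (u - t *: J u)).
Hypothesis hamel : forall (a : 'I_m) x u, D x -> u != 0 ->
  'D_(row_mx u 0) (partial (rshift m a) g) (row_mx x u) =
  c * partial (lshift m a) g (row_mx x u).
Hypotheses (c0 : c != 0) (c1 : c + 1 != 0).

Let J_neq0 u : u != 0 -> J u != 0.
Proof.
apply: contra_neq => Ju0.
by apply: oppr_inj; rewrite oppr0 -JJ Ju0.
Qed.

Let derive_vertical_J x u : D x -> u != 0 ->
  \sum_a J u 0 a * partial (rshift m a) g (row_mx x u) = 0.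
Proof.
move=> Dx u0; have := derive_row_mx 0 (J u) (dg Dx u0).
rewrite [X in _ = X + _]big1 => [|a _]; last by rewrite mxE mul0r.
rewrite add0r => <-; apply: derive_even; first exact: dg.
move=> t; rewrite !scale_row_mx scaler0 opp_row_mx !add_row_mx oppr0 addr0.
exact: gJeven.
Qed.

Let derive_horizontal x u p : D x -> u != 0 ->
  'D_(row_mx p 0) g (row_mx x u) =
  \sum_a p 0 a * partial (lshift m a) g (row_mx x u).
Proof.
move=> Dx u0; rewrite (derive_row_mx p 0 (dg Dx u0)).
by rewrite [X in _ + X]big1 ?addr0 // => a _; rewrite mxE mul0r.
Qed.

Let derive_horizontal_J x u : D x -> u != 0 ->
  'D_(row_mx (J u) 0) g (row_mx x u) = 0.
Proof.
move=> Dx u0; rewrite derive_horizontal //.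
(* Along (u, 0) only [x] moves, so the coefficients [J u] stay fixed and [derive_vertical_J] makes
   the sum vanish at all nearby points. *)
have : 'D_(row_mx u 0) (\sum_a J u 0 a *: partial (rshift m a) g) (row_mx x u) = 0.
  rewrite derive_row_mxl -[RHS](derive_cst (0 : R) x u).
  apply: near_eq_derive; near=> y.
  rewrite fct_sumE; apply: derive_vertical_J => //.
  by near: y; exact: open_nbhs_nbhs.
rewrite derive_sum => [|a]; last exact/derivableZ/diff_derivable/dpg.
(* [hamel] turns the derivative of each vertical partial into [c] times the horizontal one, and [c]
   cancels. *)
move=> E; apply: (mulfI c0); rewrite mulr0 -[RHS]E mulr_sumr; apply: eq_bigr => a _.
rewrite deriveZ; last exact/diff_derivable/dpg.
by rewrite hamel // mulrCA.
Unshelve. all: by end_near. Qed.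

Let derive_horizontal0 x u : D x -> u != 0 ->
  'D_(row_mx u 0) g (row_mx x u) = 0.
Proof.
move=> Dx u0.
have : 'D_(row_mx (- u) 0) g (row_mx x u) = 0.
  (* The previous result at [J u] concerns the direction [J (J u) = - u]; by [gJ] the fibre point
     [J u] can be replaced by [u]. *)
  rewrite -(derive_horizontal_J Dx (J_neq0 u0)) JJ !derive_row_mxl.
  apply: near_eq_derive; near=> y.
  by rewrite gJ //; near: y; exact: open_nbhs_nbhs.
rewrite !derive_horizontal // => E; apply: oppr_inj; rewrite oppr0 -[RHS]E -sumrN.
by apply: eq_bigr => a _; rewrite mxE mulNr.
Unshelve. all: by end_near. Qed.

Let constant_segment x u r (t : R) : ball x r `<=` D -> u != 0 ->
  `|t| * `|u| < r -> g (row_mx (x + t *: u) u) = g (row_mx x u).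
Proof.
move=> rD u0 tr.
have Ds s : `|s| <= `|t| -> D (x + s *: u).
  move=> st; apply: rD; rewrite -ball_normE /= opprD addNKr normrN normrZ.
  by apply: le_lt_trans tr; rewrite ler_wpM2r.
have E s : row_mx (x + s *: u) u = row_mx x u + s *: row_mx u 0.
  by rewrite scale_row_mx scaler0 add_row_mx addr0.
rewrite E; apply: constant_on_line => s /Ds Dxs; rewrite -E.
by split; [exact/diff_derivable/dg | exact: derive_horizontal0].
Qed.

(* Differentiating [g (x + t u, u) = g (x, u)] with respect to [u]. *)
Let vertical_transport x u (a : 'I_m) : D x -> u != 0 -> \forall t \near (0 : R),
  t * partial (lshift m a) g (row_mx (x + t *: u) u) +
    partial (rshift m a) g (row_mx (x + t *: u) u) =
  partial (rshift m a) g (row_mx x u).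
Proof.
move=> Dx u0; have /nbhs_ballP[r /= r0 rD] : nbhs x D by exact: open_nbhs_nbhs.
have k0 : 0 < `|u| + 1 by rewrite ltr_wpDl.
(* The extra 1 leaves room in the ball for [u + s *: e] in place of [u] when [|s| < 1]. *)
have : \forall t \near (0 : R), `|t| < r / (`|u| + 1).
  by apply: nbhs0_lt; rewrite divr_gt0.
apply: filterS => t; rewrite ltr_pdivlMr // => tr.
set e := delta_mx 0 a : 'rV[R]_m.
have Dt : D (x + t *: u).
  apply: rD; rewrite -ball_normE /= opprD addNKr normrN normrZ.
  by apply: le_lt_trans tr; rewrite ler_wpM2l // lerDl.
have -> : t * partial (lshift m a) g (row_mx (x + t *: u) u) +
    partial (rshift m a) g (row_mx (x + t *: u) u) =
    'D_(row_mx (t *: e) e) g (row_mx (x + t *: u) u).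
  rewrite derive_row_mx; last exact: dg.
  rewrite -(sum_delta a (fun b => partial (rshift m b) g _)); congr (_ + _).
  rewrite -[X in t * X](sum_delta a (fun b => partial (lshift m b) g _)).
  by rewrite mulr_sumr; apply: eq_bigr => b _; rewrite mulrA [in RHS]mxE.
rewrite /partial delta_rshift.
(* The line through (x + t u, u) in the direction (t e, e) consists of the points (x + t u', u')
   with u' = u + s e, to which [constant_segment] applies. *)
have E s : s *: row_mx (t *: e) e + row_mx (x + t *: u) u =
    row_mx (x + t *: (u + s *: e)) (u + s *: e).
  rewrite scale_row_mx add_row_mx; congr row_mx; last exact: addrC.
  by rewrite addrC -addrA; congr (_ + _); rewrite scalerDr !scalerA mulrC.
have Hs : \forall s \near (0 : R), u + s *: e != 0 /\ `|t| * `|u + s *: e| < r.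
  have e1 : `|e| <= 1.
    by apply: normrV_le => // i; rewrite mxE; case: (_ && _); rewrite ?normr1 ?normr0.
  (* The bound 1 keeps the segment in the ball; the bound [|u|] keeps [u + s *: e] nonzero. *)
  have : \forall s \near (0 : R), `|s| < Num.min 1 `|u|.
    by apply: nbhs0_lt; rewrite lt_min ltr01 normr_gt0.
  apply: filterS => s; rewrite lt_min => /andP[s1 su].
  have se : `|s *: e| <= `|s| by rewrite normrZ ler_piMr.
  split.
    apply: contraTneq su => /eqP; rewrite addr_eq0 => /eqP ->.
    by rewrite normrN -leNgt.
  apply: le_lt_trans tr; rewrite ler_wpM2l //.
  apply: le_trans (ler_normD _ _) _; rewrite lerD2l.
  exact: le_trans se (ltW s1).
transitivity ('D_1 (fun s : R => g (row_mx x (u + s *: e))) 0); last first.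
  apply: eq_derive_line => s.
  by rewrite scale_row_mx scaler0 add_row_mx add0r addr0 [_ *: 1]mulr1 addrC.
transitivity ('D_1 (fun s : R => g (row_mx (x + t *: (u + s *: e)) (u + s *: e))) 0).
  by apply: eq_derive_line => s; rewrite E addr0 [_ *: 1]mulr1.
apply: near_eq_derive; apply: filterS Hs => s [us0 usr].
exact: (constant_segment rD).
Qed.

(** The difference quotient of the vertical partial [f] along (u, 0) has two limits: [c * k] by
    [hamel], and [- k] by [vertical_transport]. Uniqueness gives (c + 1) k = 0. *)
Lemma horizontal_partial_eq0 x u (a : 'I_m) : D x -> u != 0 ->
  partial (lshift m a) g (row_mx x u) = 0.
Proof.
move=> Dx u0.
set f := partial (rshift m a) g; set k := partial (lshift m a) g.
have E t : row_mx (x + t *: u) u = row_mx x u + t *: row_mx u 0.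
  by rewrite scale_row_mx scaler0 add_row_mx addr0.
have H1 : h^-1 * (f (row_mx x u + h *: row_mx u 0) - f (row_mx x u))
    @[h --> (0 : R)^'] --> c * k (row_mx x u).
  by rewrite -(hamel a Dx u0); apply: cvg_derive; exact/diff_derivable/dpg.
have H2 : h^-1 * (f (row_mx x u + h *: row_mx u 0) - f (row_mx x u))
    @[h --> (0 : R)^'] --> - k (row_mx x u).
  have kc : k (row_mx x u + h *: row_mx u 0) @[h --> (0 : R)^'] --> k (row_mx x u).
    have L : row_mx x u + h *: row_mx u 0 @[h --> (0 : R)^'] --> row_mx x u.
      by apply: cvg_within_filter; exact: cvg_line.
    exact: (cvg_comp _ _ L (differentiable_continuous (dpg Dx u0 _))).
  (* For small nonzero [t] the transport identity says that the quotient equals [- k] at (x + t u,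
     u); continuity of [k] then gives the limit. *)
  apply: cvg_trans (cvgN kc); apply: near_eq_cvg.
  near=> t.
  have t0 : t != 0 by near: t; exact: nbhs_dnbhs_neq.
  have H : t * k (row_mx (x + t *: u) u) + f (row_mx (x + t *: u) u) =
      f (row_mx x u).
    by near: t; apply: cvg_within; exact: vertical_transport.
  by rewrite -E -H opprD addrCA subrr addr0 /= mulrN mulKf // E.
have := cvg_unique _ H1 H2 => /(_ _ _)/eqP.
rewrite -subr_eq0 opprK -[X in _ + X]mul1r -mulrDl mulf_eq0 (negbTE c1) /=.
by move=> H; apply/eqP/H.
Unshelve. all: by end_near. Qed.
End HamelRigidity.

(** * Functions with zero derivative on a connected open set *)

Lemma derive0_locally_constant (R : realType) (V : normedModType R) (D : set V)
    (f : V -> R) :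
  open D -> (forall x v, D x -> derivable f x v /\ 'D_v f x = 0) ->
  forall x, D x -> \forall y \near x, f y = f x.
Proof.
move=> oD df x Dx.
have /nbhs_ballP[r /= r0 rD] : nbhs x D by exact: open_nbhs_nbhs.
apply/nbhs_ballP; exists r => //= y; rewrite -ball_normE /= => xy.
have -> : y = x + (1 : R) *: (y - x) by rewrite scale1r addrCA subrr addr0.
apply: constant_on_line => t; rewrite normr1 => t1; apply: df; apply: rD.
rewrite -ball_normE /= opprD addNKr normrN normrZ distrC.
by apply: le_lt_trans xy; rewrite ler_piMl.
Qed.

Lemma derive0_connected_constant (R : realType) (V : normedModType R)
    (D : set V) (f : V -> R) :
  open D -> connected D ->
  (forall x v, D x -> derivable f x v /\ 'D_v f x = 0) ->
  forall x y, D x -> D y -> f x = f y.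
Proof.
move=> oD cD /(derive0_locally_constant oD) lc x y Dx Dy.
(* By local constancy any condition on the values of [f] cuts out an open part of [D]. It is applied
   to a level set and to its complement in [D], so the level set is open and closed in [D]. *)
have level (P : R -> Prop) : open [set z | D z /\ P (f z)].
  rewrite openE => z [Dz Pz]; apply: filterS2 (lc z Dz) (open_nbhs_nbhs (conj oD Dz)).
  by move=> w wz Dw; split=> //; rewrite wz.
suff E : [set z | D z /\ f x = f z] = D.
  by have [] : [set z | D z /\ f x = f z] y by rewrite E.
apply: cD; first by exists x.
  exists [set z | D z /\ f x = f z]; first exact: (level (fun s => f x = s)).
  by apply/seteqP; split=> z; [move=> [] | move=> [_ []]].
exists (~` [set z | D z /\ f x <> f z]).
  exact/open_closedC/(level (fun s => f x <> s)).
apply/seteqP; split=> z /=; first by move=> [Dz fz]; split=> // -[].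
by move=> [Dz H]; split=> //; apply: contrapT => fz; apply: H.
Qed.

(** * Second-order regularity *)

(** The regularity that the Hamel argument takes as [dg] and [dpg], in a form that passes from F to
    F^2. *)
Definition C2_on (R : realType) m (U : set 'rV[R]_m) (g : 'rV[R]_m -> R) :=
  forall w, U w ->
    differentiable g w /\ forall a, differentiable (partial a g) w.

Lemma smooth_on_C2 (R : realType) m (U : set 'rV[R]_m) (g : 'rV[R]_m -> R) :
  open U -> smooth_on U g -> C2_on U g.
Proof.
move=> oU sg.
have dg s w : U w -> differentiable (partials s g) w.
  move=> Uw; apply: continuous_partials_differentiable => a.
  split; last exact: (sg (a :: s) w Uw).1.
  by apply: filterS (open_nbhs_nbhs (conj oU Uw)) => y /(sg s)[].
by move=> w Uw; split=> [|a]; [exact: (dg [::]) | exact: (dg [:: a])].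
Qed.

Lemma C2_on_sqr (R : realType) m (U : set 'rV[R]_m) (g : 'rV[R]_m -> R) :
  open U -> C2_on U g -> C2_on U (fun w => g w ^+ 2).
Proof.
move=> oU C2g w Uw; have [dg dpg] := C2g w Uw.
have -> : (fun w => g w ^+ 2) = (g * g : _ -> R) by apply/funext => y; rewrite expr2.
split=> [|a]; first exact: differentiableM.
(* The product rule holds at every point of the open set [U], hence near [w], so the partial of the
   square may be replaced by 2 g times the partial of g. *)
apply: (@near_eq_differentiable _ _ (2%:R *: (g * partial a g : _ -> R))).
  apply: filterS (open_nbhs_nbhs (conj oU Uw)) => y /C2g[dgy _].
  rewrite /partial deriveM; [|exact: diff_derivable..].
  by rewrite -[LHS]/(2%:R * (g y * _)) mulr_natl.
by apply: differentiableZ; apply: differentiableM.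
Qed.

(** * Rigidity of real metrics on a connected domain *)

Section RealMetric.
Variables (R : realType) (m : nat) (D : set 'rV[R]_m).
Hypothesis oD : open D.

Lemma open_tangent_domain :
  open [set w : 'rV[R]_(m + m) | D (lsubmx w) /\ rsubmx w != 0].
Proof.
apply: openI.
  by apply: open_comp oD => w _; exact: continuous_lsubmx.
apply: (@open_comp _ _ (@rsubmx R 1 m m) [set u | u != 0]).
  by move=> w _; exact: continuous_rsubmx.
rewrite openE => u u0; apply/nbhs_ballP; exists `|u| => /=; first by rewrite normr_gt0.
move=> v; rewrite -ball_normE /=; apply: contraTneq => ->.
by rewrite subr0 ltxx.
Qed.

Variable G : 'rV[R]_m -> 'rV[R]_m -> R.
Let g (w : 'rV[R]_(m + m)) := G (lsubmx w) (rsubmx w).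

Let partial_l a w : partial (lshift m a) g w = dx a G (lsubmx w) (rsubmx w).
Proof.
rewrite -{1}[w]hsubmxK /partial delta_lshift derive_row_mxl /dx /partial.
by apply: eq_derive_line => h; rewrite /g row_mxKl row_mxKr.
Qed.

Let partial_r a w : partial (rshift m a) g w = du a G (lsubmx w) (rsubmx w).
Proof.
rewrite -{1}[w]hsubmxK /partial delta_rshift derive_row_mxr /du /partial.
by apply: eq_derive_line => h; rewrite /g row_mxKl row_mxKr.
Qed.

(** Common form of both cases: [G] is F with [c = 1], or F^2 with [c = 2]. The partials in [x]
    vanish by the Hamel argument, and connectedness of [D] makes [G] independent of [x]. *)
Lemma real_rigidity (J : 'rV[R]_m -> 'rV[R]_m) (c : R) :
  connected D ->
  C2_on [set w : 'rV[R]_(m + m) | D (lsubmx w) /\ rsubmx w != 0] g ->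
  J 0 = 0 -> (forall u, J (J u) = - u) ->
  (forall x u, D x -> G x (J u) = G x u) ->
  (forall x u (t : R), D x -> G x (u + t *: J u) = G x (u - t *: J u)) ->
  c != 0 -> c + 1 != 0 ->
  (forall x u, D x -> u != 0 -> forall a : 'I_m,
    \sum_(b < m) dx b (du a G) x u * u 0 b = c * dx a G x u) ->
  forall x y u, D x -> D y -> u != 0 -> G x u = G y u.
Proof.
move=> cD C2g J0 JJ GJ GJe c0 c1 hamel x y u Dx Dy u0.
have C2 z v : D z -> v != 0 -> differentiable g (row_mx z v) /\
    forall a, differentiable (partial a g) (row_mx z v).
  by move=> Dz v0; apply: C2g; rewrite /= row_mxKl row_mxKr.
have gE z v : g (row_mx z v) = G z v by rewrite /g row_mxKl row_mxKr.
have dg z v (Dz : D z) (v0 : v != 0) := (C2 z v Dz v0).1.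
have dpg z v (Dz : D z) (v0 : v != 0) := (C2 z v Dz v0).2.
(* The sum in Hamel's equations is the derivative of the vertical partial along (q, 0). *)
have hamel_g b p q : D p -> q != 0 ->
    'D_(row_mx q 0) (partial (rshift m b) g) (row_mx p q) =
    c * partial (lshift m b) g (row_mx p q).
  move=> Dp q0; rewrite partial_l row_mxKl row_mxKr -hamel //.
  rewrite derive_row_mx; last exact: dpg.
  rewrite [X in _ + X]big1 ?addr0 => [|d _]; last by rewrite mxE mul0r.
  apply: eq_bigr => d _.
  suff -> : dx d (du b G) p q =
      partial (lshift m d) (partial (rshift m b) g) (row_mx p q) by exact: mulrC.
  rewrite -[RHS]/('D_(delta_mx 0 (lshift m d)) (partial (rshift m b) g) (row_mx p q)).
  rewrite delta_lshift derive_row_mxl; apply: eq_derive_line => h.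
  by rewrite partial_r row_mxKl row_mxKr.
have gJ p q : D p -> g (row_mx p (J q)) = g (row_mx p q).
  by move=> Dp; rewrite !gE GJ.
have gJe p q (t : R) : D p -> g (row_mx p (q + t *: J q)) = g (row_mx p (q - t *: J q)).
  by move=> Dp; rewrite !gE GJe.
have D0 a z v : D z -> v != 0 -> partial (lshift m a) g (row_mx z v) = 0.
  exact: (@horizontal_partial_eq0 R m D g J c oD dg dpg J0 JJ gJ gJe hamel_g c0 c1).
rewrite -2!gE; apply: (@derive0_connected_constant _ _ D (fun z => g (row_mx z u))) => //.
move=> z v Dz; split.
  exact/derivable_row_mxl/diff_derivable/dg.
rewrite -derive_row_mxl derive_row_mx; last exact: dg.
rewrite [X in X + _]big1 => [|a _]; last by rewrite D0 // mulr0.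
by rewrite add0r big1 // => a _; rewrite mxE mul0r.
Qed.
End RealMetric.

(** * The identification of C^n with R^(2n) and multiplication by i *)

Section RealComplex.
Variables (R : realType) (n : nat).
Implicit Types (z : 'rV[R[i]%C]_n) (x u : 'rV[R]_(n + n)).

Lemma to_realK z : to_complex (to_real z) = z.
Proof.
apply/rowP => k; rewrite !mxE (unsplitK (inl k)) (unsplitK (inr k)) !mxE.
by case: (z 0 k).
Qed.

Lemma to_complexK x : to_real (to_complex x) = x.
Proof.
by rewrite -[RHS]hsubmxK; congr row_mx; apply/rowP => k; rewrite !mxE.
Qed.

Lemma to_real_neq0 z : z != 0 -> to_real z != 0.
Proof.
apply: contra_neq => z0; rewrite -(to_realK z) z0.
by apply/rowP => k; rewrite !mxE.
Qed.

Lemma to_complexD x u : to_complex (x + u) = to_complex x + to_complex u.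
Proof. by apply/rowP => k; rewrite !mxE. Qed.

Lemma to_complexZ (t : R) x : to_complex (t *: x) = (t%:C)%C *: to_complex x.
Proof. by apply/rowP => k; rewrite !mxE; simpc. Qed.

(** The bound for real parts applied to iz, whose real part is minus the imaginary part of z. *)
Lemma normc_ge_Im (z : R[i]%C) : (`|complex.Im z|%:C)%C <= `|z|.
Proof.
have := normc_ge_Re (z * 'i%C); rewrite ReiNIm normrN normrM.
by rewrite [`|'i%C|]normc_def /= expr0n expr1n add0r sqrtr1 mulr1.
Qed.

Lemma ball_complex_ReIm (z w e : R[i]%C^o) : ball z e w ->
  ball (complex.Re z) (complex.Re e) (complex.Re w) /\
  ball (complex.Im z) (complex.Re e) (complex.Im w).
Proof.
rewrite -!ball_normE /= => zw; rewrite -!raddfB.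
have lt_e (r : R) : (r%:C)%C <= `|z - w| -> r < complex.Re e.
  by move=> /le_lt_trans/(_ zw); rewrite ltcE => /andP[].
by split; apply: lt_e; [exact: normc_ge_Re | exact: normc_ge_Im].
Qed.

Lemma ball_complex (z w : R[i]%C^o) (e : R) :
  ball (complex.Re z) (e / 2) (complex.Re w) ->
  ball (complex.Im z) (e / 2) (complex.Im w) ->
  ball z (e%:C)%C w.
Proof.
rewrite -!ball_normE /= -!raddfB => re im.
rewrite [z - w]complexE; apply: le_lt_trans (ler_normD _ _) _.
rewrite normrM [`|'i%C|]normc_def !normc_def /= !expr0n expr1n add0r sqrtr1 mul1r.
by rewrite !addr0 !sqrtr_sqr -rmorphD ltcR [e]splitr ltrD.
Qed.

Lemma to_real_continuous :
  continuous (@to_real R n : 'rV[R[i]%C^o]_n -> 'rV[R]_(n + n)).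
Proof.
move=> z A /nbhs_ballP[e /= e0 eA].
apply/nbhs_ballP; exists (e%:C)%C; first by rewrite /= ltcR.
move=> w [_ zw]; apply: eA; split=> // i j; rewrite ord1 !mxE.
by case: splitP => k _; rewrite !mxE; have [] := ball_complex_ReIm (zw 0 k).
Qed.

Lemma to_complex_continuous :
  continuous (@to_complex R n : 'rV[R]_(n + n) -> 'rV[R[i]%C^o]_n).
Proof.
move=> x A /nbhs_ballP[e /= e0 eA].
have [e1 e2] : 0 < complex.Re e /\ e = ((complex.Re e)%:C)%C.
  move: e0; rewrite ltcE /= => /andP[/eqP I0 ->]; split=> //.
  by case: e I0 {eA} => a b /= ->.
apply/nbhs_ballP; exists (complex.Re e / 2); first by rewrite /= divr_gt0.
move=> y [_ xy]; apply: eA; split=> // i j; rewrite ord1 !mxE e2.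
by apply: ball_complex; apply: xy.
Qed.

Lemma open_real_domain (D : set 'rV[R[i]%C]_n) :
  open (D : set 'rV[R[i]%C^o]_n) -> open (real_domain D).
Proof. by apply: open_comp => x _; exact: to_complex_continuous. Qed.

(** Though defined as a preimage, [real_domain D] is also the image of [D] under the continuous map
    [to_real]. *)
Lemma connected_real_domain (D : set 'rV[R[i]%C]_n) :
  connected (D : set 'rV[R[i]%C^o]_n) -> connected (real_domain D).
Proof.
move=> cD; have -> : real_domain D = @to_real R n @` D.
  apply/seteqP; split=> [x Dx|_ [z Dz <-]].
    by exists (to_complex x); rewrite ?to_complexK.
  by rewrite /real_domain /= to_realK.
apply: (@connected_continuous_connected _ _ (D : set 'rV[R[i]%C^o]_n) (@to_real R n) cD).
exact/continuous_subspaceT/to_real_continuous.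
Qed.

(** Multiplication by i in real coordinates, the [J] of the rigidity argument. *)
Definition rotate x : 'rV[R]_(n + n) := to_real ('i%C *: to_complex x).

Lemma rotate0 : rotate 0 = 0.
Proof.
have t0 : to_complex (0 : 'rV[R]_(n + n)) = 0 by apply/rowP => k; rewrite !mxE.
by rewrite /rotate t0 scaler0 -t0 to_complexK.
Qed.

Lemma rotateK x : rotate (rotate x) = - x.
Proof.
rewrite /rotate to_realK scalerA -expr2 sqr_i -[RHS]to_complexK; congr to_real.
by rewrite -(scaleN1r x) to_complexZ rmorphN1.
Qed.

Lemma complex_minkowski_scale (f : 'rV[R[i]%C]_n -> R) (a b : R[i]%C) z :
  complex_minkowski f -> `|a| = `|b| -> f (a *: z) = f (b *: z).
Proof. by case=> _ _ hf _ ab; apply: complexI; rewrite !hf ab. Qed.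

Lemma minkowski_rotate (f : 'rV[R[i]%C]_n -> R) u : complex_minkowski f ->
  f (to_complex (rotate u)) = f (to_complex u).
Proof.
move=> hf; rewrite to_realK -[in RHS](scale1r (to_complex u)).
apply: complex_minkowski_scale => //.
by rewrite normr1 normc_def /= expr0n expr1n add0r sqrtr1.
Qed.

Lemma minkowski_rotate_even (f : 'rV[R[i]%C]_n -> R) u (t : R) :
  complex_minkowski f ->
  f (to_complex (u + t *: rotate u)) = f (to_complex (u - t *: rotate u)).
Proof.
move=> hf.
(* Adding s times iu multiplies u by 1 + is, and 1 + it and 1 - it have the same modulus. *)
have E s : to_complex (u + s *: rotate u) = (1 +i* s)%C *: to_complex u.
  rewrite to_complexD to_complexZ to_realK scalerA -[X in X + _]scale1r -scalerDl.
  congr (_ *: _); apply/eqP; rewrite eq_complex /=.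
  by rewrite !(mulr0, mul0r, mulr1, subr0, addr0, add0r) !eqxx.
rewrite -scaleNr !E; apply: complex_minkowski_scale => //.
by rewrite !normc_def /= sqrrN.
Qed.
End RealComplex.

(** * Flat complex Finsler metrics do not depend on the base point *)

Section Flatness.
Variables (R : realType) (n : nat) (D : set 'rV[R[i]%C]_n).
Variable F : 'rV[R[i]%C]_n -> 'rV[R[i]%C]_n -> R.
Hypotheses (hD : complex_domain D) (hF : complex_finsler D F)
  (hconv : strongly_convex_metric D F).
Let oD : open (real_domain D). Proof. by apply: open_real_domain; case: hD. Qed.
Let cD : connected (real_domain D).
Proof. by apply: connected_real_domain; case: hD. Qed.

Let C2F : C2_on
  [set w : 'rV[R]_(n + n + (n + n)) | real_domain D (lsubmx w) /\ rsubmx w != 0]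
  (fun w => to_real_metric F (lsubmx w) (rsubmx w)).
Proof. apply: smooth_on_C2; [exact: open_tangent_domain | exact: hF.1]. Qed.

Lemma projectively_flat_constant : projectively_flat D F ->
  forall z w v, D z -> D w -> v != 0 -> F z v = F w v.
Proof.
move=> flat z w v Dz Dw v0.
have := @real_rigidity _ _ _ oD (to_real_metric F) (@rotate R n) 1 cD C2F
  (rotate0 _ _) (@rotateK R n).
move=> /(_ _ _ _ _ _ (to_real z) (to_real w) (to_real v)).
rewrite /to_real_metric !to_realK; apply.
- by move=> x u Dx; apply: minkowski_rotate; exact: hF.2.
- by move=> x u t Dx; apply: minkowski_rotate_even; exact: hF.2.
- exact: oner_neq0.
- by rewrite gt_eqF.
- by move=> x u Dx u0 a; rewrite mul1r; exact: flat.
- by rewrite /real_domain /= to_realK.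
- by rewrite /real_domain /= to_realK.
- exact: to_real_neq0.
Qed.

Lemma dually_flat_constant : dually_flat D F ->
  forall z w v, D z -> D w -> v != 0 -> F z v = F w v.
Proof.
move=> flat z w v Dz Dw v0.
have := @real_rigidity _ _ _ oD (fun x u => to_real_metric F x u ^+ 2)
  (@rotate R n) 2%:R cD
  (C2_on_sqr (open_tangent_domain oD) C2F) (rotate0 _ _) (@rotateK R n).
move=> /(_ _ _ _ _ _ (to_real z) (to_real w) (to_real v)).
rewrite /to_real_metric !to_realK => H.
have [[F0 _ _ _] [F0' _ _ _]] := (hF.2 z Dz, hF.2 w Dw).
(* Rigidity concerns F^2; as F is nonnegative, equal squares give equal values. *)
apply/eqP; rewrite -(@eqrXn2 _ 2) //; apply/eqP; apply: H.
- by move=> x u Dx; rewrite minkowski_rotate //; exact: hF.2.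
- by move=> x u t Dx; rewrite minkowski_rotate_even //; exact: hF.2.
- by rewrite gt_eqF.
- by rewrite gt_eqF // addr_gt0.
- by move=> x u Dx u0 a; exact: flat.
- by rewrite /real_domain /= to_realK.
- by rewrite /real_domain /= to_realK.
- exact: to_real_neq0.
Qed.

Lemma minkowski_of_constant :
  (forall z w v, D z -> D w -> v != 0 -> F z v = F w v) ->
  exists f : 'rV[R[i]%C]_n -> R,
       [/\ complex_minkowski f, strongly_convex_norm f
         & forall z v, D z -> F z v = f v].
Proof.
move=> cF; have [[z0 Dz0] _ _] := hD.
exists (F z0); split; first exact: hF.2.
  have := hconv.2 (to_real z0); rewrite /real_domain /= to_realK => /(_ Dz0).
  by rewrite /to_real_metric to_realK.
(* Constancy is known for nonzero [v] only; at 0 homogeneity forces the value 0. *)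
move=> z v Dz; have [->|v0] := eqVneq v 0; last exact: cF.
have F0 w : D w -> F w 0 = 0.
  case/hF.2 => _ _ hom _; apply: complexI.
  by rewrite -(scale0r (0 : 'rV[R[i]%C]_n)) hom normr0 mul0r.
by rewrite !F0.
Qed.
End Flatness.

(** * The converse direction and the equivalences *)

Lemma constant_metric_derivatives (R : realType) m (D : set 'rV[R]_m)
    (G : 'rV[R]_m -> 'rV[R]_m -> R) (f : 'rV[R]_m -> R) :
  open D -> (forall x u, D x -> G x u = f u) ->
  forall x u a b, D x -> dx a G x u = 0 /\ dx b (du a G) x u = 0.
Proof.
move=> oD Gf x u a b Dx.
(* Values are controlled only over [D], which is open and so contains a neighbourhood of [x]. *)
have cst0 (h : 'rV[R]_m -> R) (r : R) c : (forall y, D y -> h y = r) -> partial c h x = 0.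
  move=> hr; rewrite /partial -[RHS](derive_cst r x (delta_mx 0 c)).
  by apply: near_eq_derive; apply: filterS (open_nbhs_nbhs (conj oD Dx)) => y /hr.
split; first by apply: (cst0 _ (f u)) => y /Gf ->.
apply: (cst0 _ (partial a f u)) => y Dy.
by rewrite /du; congr (partial a _ u); apply/funext => w; exact: Gf.
Qed.

Theorem theorem1p1 (R : realType) (n : nat) (D : set 'rV[R[i]%C]_n)
    (F : 'rV[R[i]%C]_n -> 'rV[R[i]%C]_n -> R)
    (hD : complex_domain D)
    (hF : complex_finsler D F)
    (hconv : strongly_convex_metric D F) :
  (projectively_flat D F <->
     exists f : 'rV[R[i]%C]_n -> R,
       [/\ complex_minkowski f, strongly_convex_norm f
         & forall z v, D z -> F z v = f v]) /\
  (dually_flat D F <->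
     exists f : 'rV[R[i]%C]_n -> R,
       [/\ complex_minkowski f, strongly_convex_norm f
         & forall z v, D z -> F z v = f v]).
Proof.
have oD : open (real_domain D) by apply: open_real_domain; case: hD.
split; split.
- by move=> /(projectively_flat_constant hD hF); exact: minkowski_of_constant.
- move=> [f [_ _ Ff]] x u Dx _ a.
  have H := @constant_metric_derivatives _ _ _ (to_real_metric F) _ oD
    (fun y w Dy => Ff (to_complex y) (to_complex w) Dy).
  (* Both sides of Hamel's equation contain only derivatives in [x], so both are 0. *)
  by rewrite (H x u a a Dx).1 big1 // => b _; rewrite (H x u a b Dx).2 mul0r.
- by move=> /(dually_flat_constant hD hF); exact: minkowski_of_constant.
- move=> [f [_ _ Ff]] F2 x u Dx _ a.
  have H := @constant_metric_derivatives _ _ _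
    (fun y w => to_real_metric F y w ^+ 2) _ oD (fun y w Dy => congr1 (fun r => r ^+ 2)
      (Ff (to_complex y) (to_complex w) Dy)).
  by rewrite (H x u a a Dx).1 mulr0 big1 // => b _; rewrite (H x u a b Dx).2 mul0r.
Qed.
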